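(* Let $s,t$ be integers with $1\leqslant s\leqslant t$, and let $h$ be an integer with $0\leqslant h\leqslant s$. Then $$\kappa^{(h)}(EH(s,t))=\lambda^{(h)}(EH(s,t))=2^h(s+1-h).$$
   Context: For integers $s,t\geqslant 1$, the exchanged hypercube $EH(s,t)$ is the graph whose vertices are the binary strings $u=u_{s+t}u_{s+t-1}\cdots u_1u_0$ of length $s+t+1$. Two vertices $u,v$ are adjacent if and only if one of the following three conditions holds: (i) $u$ and $v$ differ exactly in the last bit $u_0$; (ii) $u$ and $v$ differ in exactly one bit $u_r$ with $1\leqslant r\leqslant t$, and $u_0=v_0=1$; (iii) $u$ and $v$ differ in exactly one bit $u_r$ with $t+1\leqslant r\leqslant s+t$, and $u_0=v_0=0$. For a connected graph $G$ and an integer $h\geqslant 0$: - A vertex subset $S\subset V(G)$ is an $h$-vertex-cut if $G-S$ is disconnected and every vertex of $G-S$ has degree at least $h$ in $G-S$. - An edge subset $F\subset E(G)$ is an $h$-edge-cut if $G-F$ is disconnected and every vertex of $G-F$ has degree at least $h$ in $G-F$. - $\kappa^{(h)}(G)$ is the minimum cardinality of an $h$-vertex-cut of $G$. - $\lambda^{(h)}(G)$ is the minimum cardinality of an $h$-edge-cut of $G$. In particular, $\kappa^{(0)}$ and $\lambda^{(0)}$ are the ordinary connectivity and edge-connectivity. *)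

(* Defs.v *)
From mathcomp Require Import all_boot.

Set Implicit Arguments.
Unset Strict Implicit.
Unset Printing Implicit Defensive.

(* A finite simple graph is a finType of vertices with a symmetric irreflexive
   adjacency relation. *)

Section Graphs.

Variables (V : finType) (e : rel V).

(* The graph without vertices is not disconnected. *)
Definition disconnected : bool := [exists x, exists y, ~~ connect e x y].

Definition degree (x : V) : nat := #|[set y | e x y]|.

Definition min_degree_ge (h : nat) : bool := [forall x, h <= degree x].

Definition edges : {set {set V}} :=
  [set [set p.1; p.2] | p : V * V & e p.1 p.2].

(* G - S, whose vertex type is V minus S. *)
Definition del_vertices (S : {set V}) : rel {x : V | x \notin S} :=
  fun x y => e (val x) (val y).

(* G - F, which keeps all the vertices. *)
Definition del_edges (F : {set {set V}}) : rel V :=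
  fun x y => e x y && ([set x; y] \notin F).

End Graphs.

Arguments del_vertices {V} e S x y.

Definition vertex_cut (V : finType) (e : rel V) (h : nat) (S : {set V}) : bool :=
  disconnected (del_vertices e S) &&
  min_degree_ge (del_vertices e S) h.

Definition edge_cut (V : finType) (e : rel V) (h : nat) (F : {set {set V}}) :
    bool :=
  [&& F \subset edges e, disconnected (del_edges e F) &
      min_degree_ge (del_edges e F) h].

(* None when no set satisfies P: the minimum is then undefined. *)
Definition min_card (T : finType) (P : pred {set T}) : option nat :=
  omap (fun A : {set T} => #|A|)
    [pick A | P A && [forall B, P B ==> (#|A| <= #|B|)]].

Definition kappa (h : nat) (V : finType) (e : rel V) : option nat :=
  min_card (vertex_cut e h).

Definition lambda (h : nat) (V : finType) (e : rel V) : option nat :=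
  min_card (edge_cut e h).

(* The string u_{s+t} ... u_1 u_0 is the function r |-> u_r, so that the last
   bit u_0 is u ord0. *)
Definition EH_vertex (s t : nat) : finType := {ffun 'I_(s + t).+1 -> bool}.

Section ExchangedHypercube.

Variables (s t : nat).
Implicit Types u v : EH_vertex s t.

Definition differ_exactly_at u v (r : 'I_(s + t).+1) : bool :=
  [forall i, (u i != v i) == (i == r)].

Definition EH : rel (EH_vertex s t) := fun u v =>
  [|| differ_exactly_at u v ord0,
      [exists r : 'I_(s + t).+1,
         [&& 1 <= r <= t, differ_exactly_at u v r,
             u ord0 == true & v ord0 == true]] |
      [exists r : 'I_(s + t).+1,
         [&& t + 1 <= r <= s + t, differ_exactly_at u v r,
             u ord0 == false & v ord0 == false]]].

Lemma EH_sym : symmetric EH.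
Proof.
have D u v r : differ_exactly_at u v r = differ_exactly_at v u r.
  by rewrite /differ_exactly_at; apply: eq_forallb => i; rewrite (eq_sym (u i)).
move=> u v; rewrite /EH D; congr (_ || (_ || _)).
  by apply: eq_existsb => r; rewrite D [(u _ == _) && _]andbC.
by apply: eq_existsb => r; rewrite D [(u _ == _) && _]andbC.
Qed.

Lemma EH_irrefl : irreflexive EH.
Proof.
have D u r : differ_exactly_at u u r = false.
  by apply/negbTE/forallPn; exists r; rewrite !eqxx.
move=> u; apply/negbTE; rewrite /EH D /= negb_or.
by apply/andP; split; apply/existsPn => r; rewrite D andbF.
Qed.

End ExchangedHypercube.

Arguments EH s t u v : clear implicits.

(* Main.v *)
Require Import Defs.
From mathcomp Require Import all_boot zify.

(* Lower bound: from a cut one gets disjoint nonempty vertex sets X and Y of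
   inner degree at least h, and the deleted vertices and edges together
   account for every vertex outside X and Y and every edge between X and Y;
   both kinds of cut are counted at once as "mixed cuts". Each of the two sides
   (u_0 = 1 and u_0 = 0) is a disjoint union of cubes. If on each side some cube
   meets both X and Y, these two cubes contribute 2^(h-1) (s - h + 1) each (s each
   when h = 0).
   Otherwise on some side either X or Y is absent, and the edges in direction 0
   charge the closed neighbourhood of that set, or all cubes are pure, and 2^s
   disjoint connected subgraphs joining X to Y all contain a cut element.
   Upper bound: separate an h-dimensional subcube of the side u_0 = 0. *)

Set Implicit Arguments.
Unset Strict Implicit.
Unset Printing Implicit Defensive.

(** Adds up two halves that have each lost one degree. For [h > 0] both sides agree; for [h = 0] the
    truncated [h.-1] is 0, and [d.+1 <= d.*2] needs [0 < d]. *)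
Lemma leq_double_bound d h : (0 < d) || (0 < h) ->
  2 ^ h * (d.+1 - h) <= (2 ^ h.-1 * (d - h.-1)).*2.
Proof.
case: h => [|h] /=; first by rewrite orbF !mul1n !subn0; lia.
by rewrite subSS expnS -mulnA mul2n.
Qed.

(** After division by [2 ^ h] this is [n + 1 <= 2 ^ n] for [n = d - h]. *)
Lemma leq_exp_bound d h : h <= d -> 2 ^ h * (d + 1 - h) <= 2 ^ d.
Proof.
move=> le_hd; rewrite -[in X in _ <= X](subnKC le_hd) expnD leq_mul2l.
by rewrite addn1 subSn // ltn_expl ?orbT.
Qed.

(** * Flips and subcubes of the hypercube *)

Section Cube.

Variable I : finType.
Local Notation V := {ffun I -> bool}.
Implicit Types (u v x y : V) (i j : I) (D : {set I}) (C X Y : {set V}).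

Definition flip i u : V := [ffun j => (j == i) (+) u j].

Lemma flipE i u j : flip i u j = (j == i) (+) u j.
Proof. exact: ffunE. Qed.

Lemma flipK i : involutive (flip i).
Proof. by move=> u; apply/ffunP => j; rewrite !flipE addbA addbb. Qed.

Lemma flip_inj u : injective (flip ^~ u).
Proof.
move=> i j /ffunP/(_ i); rewrite !flipE eqxx => /addIb.
by move=> /esym/eqP.
Qed.

(** The subcube through [u] with free directions [D]. *)
Definition coset D u : {set V} := [set v : V | [forall i, (i \in D) || (v i == u i)]].

Lemma cosetP D u v :
  reflect (forall i, i \notin D -> v i = u i) (v \in coset D u).
Proof.
rewrite inE; apply: (iffP forallP) => [H i /negbTE Di | H i].
  by move: (H i); rewrite Di => /eqP.
by case: (boolP (i \in D)) => //= /H ->.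
Qed.

Lemma coset_refl D u : u \in coset D u.
Proof. exact/cosetP. Qed.

Lemma flip_coset D u v i : i \in D -> (flip i v \in coset D u) = (v \in coset D u).
Proof.
move=> Di; apply/cosetP/cosetP => H j Dj; move: (H j Dj); rewrite flipE.
  by case: eqP Dj => [->|//]; rewrite Di.
by case: eqP Dj => [->|//]; rewrite Di.
Qed.

Lemma coset_sub D D' u v : D \subset D' -> v \in coset D' u ->
  coset D v \subset coset D' u.
Proof.
move=> sD /cosetP Hv; apply/subsetP => w /cosetP Hw; apply/cosetP => i D'i.
by rewrite Hw ?Hv //; apply: contra D'i; apply: (subsetP sD).
Qed.

(** Connectedness of subcubes, as an induction principle: a flip undoes one of the coordinates in
    which [v] differs from [u]. *)
Lemma coset_connected D u (P : pred V) :
  (forall v i, v \in coset D u -> i \in D -> P v -> P (flip i v)) ->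
  P u -> {in coset D u, forall v, P v}.
Proof.
move=> HP Pu v; have [n] := ubnP #|[set i | v i != u i]|.
elim: n v => // n IH v ltn Cv.
have [E|] := set_0Vmem [set i | v i != u i].
  suff -> : v = u by [].
  apply/ffunP => i; apply/eqP; apply/negPn.
  by move/setP/(_ i): E; rewrite !inE => ->.
case=> i iin; have Di : i \in D.
  by apply: contraLR iin => /(cosetP _ _ _ Cv); rewrite inE => ->; rewrite eqxx.
rewrite -[v](flipK i); apply: HP => //; first by rewrite flip_coset.
apply: IH; last by rewrite flip_coset.
rewrite -ltnS; apply: leq_trans ltn; rewrite ltnS.
apply: proper_card; apply/properP; split.
  apply/subsetP => j; rewrite !inE flipE; case: (j =P i) => [-> _|_ //].
  by move: iin; rewrite inE.
exists i => //; rewrite !inE flipE eqxx /= negbK.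
by move: iin; rewrite inE; case: (v i); case: (u i).
Qed.

(** * Inner degrees, sizes and closed neighbourhoods in the cube *)

Definition min_deg D h C X :=
  forall x, x \in C -> x \in X -> h <= #|[set i in D | flip i x \in X]|.

Definition half i b X := [set x in X | x i == b].

(** A flip along any direction other than [i] keeps coordinate [i], so only the neighbour along [i]
    is lost. *)
Lemma min_deg_half D h C X i b :
  min_deg D h C X -> min_deg (D :\ i) h.-1 C (half i b X).
Proof.
move=> H x Cx; rewrite inE => /andP[Xx /eqP xb].
apply: (@leq_trans #|[set j in D | flip j x \in X] :\ i|).
  move: (H x Cx Xx); rewrite (cardsD1 i [set j in D | flip j x \in X]).
  by case: (i \in _); lia.
apply/subset_leq_card/subsetP => j; rewrite !inE flipE xb.
by case/and3P=> nji -> ->; rewrite nji [i == j]eq_sym (negbTE nji) /= eqxx.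
Qed.

Arguments min_deg_half {D h C X} i b _ x _ _.

Lemma card_half i X : #|half i true X| + #|half i false X| = #|X|.
Proof.
rewrite -(cardsID [set x : V | x i] X); congr (_ + _); apply: eq_card => x;
  rewrite !inE andbC; case: (x i) => //=; by rewrite ?andbT ?andbF.
Qed.

(* If the minimum degree is positive, some coordinate splits X, and halving
   along it lowers the minimum degree by at most one. *)
Lemma card_min_deg D h X : min_deg D h setT X -> X != set0 -> 2 ^ h <= #|X|.
Proof.
elim: h D X => [|h IH] D X H; first by rewrite card_gt0.
case/set0Pn => x Xx; have := H x (in_setT _) Xx.
case/(leq_trans (ltn0Sn _))/card_gt0P => i; rewrite inE => /andP[_ Xix].
rewrite -(card_half i X) expnS mul2n -addnn.
have N b : half i b X != set0.
  apply/set0Pn; exists (if x i == b then x else flip i x).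
  by case: ifP => E; rewrite inE ?Xx ?E // Xix flipE eqxx; move: E; case: (x i); case: b.
by apply: leq_add; apply: (IH (D :\ i)) => //; have := min_deg_half i _ H; apply.
Qed.

(** Flips along [D] stay in the subcube, which thus has inner degree [#|D|]. *)
Lemma card_coset D u : 2 ^ #|D| <= #|coset D u|.
Proof.
apply: (@card_min_deg D); last by apply/set0Pn; exists u; apply: coset_refl.
move=> x _ Cx; apply/subset_leq_card/subsetP => i Di.
by rewrite inE Di flip_coset.
Qed.

Definition nbhd D X := [set v : V | (v \in X) || [exists i in D, flip i v \in X]].

Lemma nbhdS D D' X X' : D \subset D' -> X \subset X' -> nbhd D X \subset nbhd D' X'.
Proof.
move=> sD sX; apply/subsetP => v; rewrite !inE => /orP[/(subsetP sX) -> //|].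
case/exists_inP => i Di Xi; apply/orP; right; apply/exists_inP.
by exists i; [apply: (subsetP sD) | apply: (subsetP sX)].
Qed.

Lemma nbhd_half D i b X v : i \notin D -> v \in nbhd D (half i b X) -> v i = b.
Proof.
move=> nDi; rewrite inE => /orP[|/exists_inP[j Dj]]; rewrite inE => /andP[_ /eqP] //.
by rewrite flipE; case: eqP => // E; move: nDi; rewrite E Dj.
Qed.

Lemma half_id i b X : (forall x, x \in X -> x i = b) -> half i b X = X.
Proof.
move=> H; apply/setP => x; rewrite inE; case: (boolP (x \in X)) => //= Xx.
by rewrite H // eqxx.
Qed.

Lemma half_eq0 i b X : half i b X = set0 -> forall x, x \in X -> x i = ~~ b.
Proof.
move=> /setP E x Xx; move: (E x); rewrite !inE Xx /= => /negbT.
by case: (x i); case: b {E}.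
Qed.

(** A flip along [i] leaves the half containing [X], so direction [i] contributes nothing to the
    inner degree. *)
Lemma min_deg_unsplit D h C X i b :
  (forall x, x \in X -> x i = b) -> min_deg D h C X -> min_deg (D :\ i) h C X.
Proof.
move=> Xb H x Cx Xx; apply: leq_trans (H x Cx Xx) _.
apply/subset_leq_card/subsetP => j; rewrite !inE => /andP[Dj Xj].
rewrite Dj Xj !andbT; apply/eqP => E; move: (Xb _ Xj).
by rewrite E flipE eqxx (Xb _ Xx); case: (b).
Qed.

Lemma min_degD1 D h C C' X i :
  C' \subset C -> min_deg D h C X -> min_deg (D :\ i) h.-1 C' X.
Proof.
move=> sC H x /(subsetP sC) Cx Xx; have := H x Cx Xx.
rewrite (cardsD1 i [set j in D | flip j x \in X]) => Hx.
apply: (@leq_trans #|[set j in D | flip j x \in X] :\ i|).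
  by move: Hx; case: (i \in _); lia.
by apply/subset_leq_card/subsetP => j; rewrite !inE andbA.
Qed.

(** Induction on [#|D|], splitting along some [i]. If [X] meets both halves, each part loses at most
    one degree and their neighbourhoods along [D :\ i] are disjoint, so the two bounds add up. *)
Lemma card_nbhd D h X : min_deg D h setT X -> X != set0 ->
  2 ^ h * (#|D| + 1 - h) <= #|nbhd D X|.
Proof.
have [n] := ubnP #|D|; elim: n D h X => // n IH D h X ltn H X0.
have [D0|[i Di]] := set_0Vmem D.
  apply: (@leq_trans #|X|); last first.
    by apply/subset_leq_card/subsetP => x Xx; rewrite inE Xx.
  apply: leq_trans (card_min_deg H X0); rewrite D0 cards0.
  by case: h H => [|h] //; rewrite subSS sub0n muln0.
have cD : #|D| = #|D :\ i|.+1 by rewrite (cardsD1 i) Di.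
have nD : i \notin D :\ i by rewrite !inE eqxx.
have sD : D :\ i \subset D by exact: subD1set.
(* If [X] lies in one half, its mirror image under [flip i] lies in the other and adds at least
   [2 ^ h] vertices to the neighbourhood along [D :\ i]. *)
have key b : half i b X = set0 -> 2 ^ h * (#|D| + 1 - h) <= #|nbhd D X|.
  move=> E0; have Xb := half_eq0 E0.
  have H' := min_deg_unsplit Xb H.
  have IH' := IH (D :\ i) h X _ H' X0.
  apply: (@leq_trans (#|nbhd (D :\ i) X| + #|flip i @: X|)).
    rewrite (card_imset _ (can_inj (flipK i))).
    apply: leq_trans (leq_add (IH' _) (card_min_deg H X0)); last by lia.
    rewrite cD -[X in _ <= _ + X]muln1 -mulnDr leq_mul2l; lia.
  rewrite -cardsUI (_ : _ :&: _ = set0) ?cards0 ?addn0.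
    apply: subset_leq_card; rewrite subUset nbhdS //=.
    apply/subsetP => _ /imsetP[x Xx ->]; rewrite inE; apply/orP; right.
    by apply/exists_inP; exists i => //; rewrite flipK.
  apply/setP => v; rewrite !inE; apply/negP => /andP[Hv /imsetP[x Xx E]].
  have : v i = ~~ b.
    apply: (@nbhd_half (D :\ i) i _ X) => //; rewrite half_id //.
    by rewrite inE.
  by rewrite E flipE eqxx (Xb _ Xx); case: b {Xb E0}.
have [/key //|Ht] := eqVneq (half i true X) set0.
have [/key //|Hf] := eqVneq (half i false X) set0.
have IHb b : half i b X != set0 ->
    2 ^ h.-1 * (#|D :\ i| + 1 - h.-1) <= #|nbhd (D :\ i) (half i b X)|.
  by move=> nX; apply: IH nX; [lia | apply: min_deg_half].
apply: (@leq_trans (#|nbhd (D :\ i) (half i true X)| + #|nbhd (D :\ i) (half i false X)|)).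
  apply: leq_trans (leq_add (IHb true Ht) (IHb false Hf)).
  by rewrite cD addnn addn1 [in X in _ <= X]addn1; apply: leq_double_bound.
rewrite -cardsUI (_ : _ :&: _ = set0) ?cards0 ?addn0.
  apply: subset_leq_card; rewrite subUset; apply/andP.
  by split; apply: nbhdS => //; apply/subsetP => x; rewrite inE => /andP[].
apply/setP => v; rewrite inE [RHS]inE; apply/negP.
by case/andP=> /(nbhd_half nD) E /(nbhd_half nD); rewrite E.
Qed.

(** * Mixed cuts inside a subcube *)

Section Cut.

Variable e : rel V.

(* Mixed cuts: the deleted vertices v are encoded as the pairs (v, v). *)
Definition cut C X Y : {set V * V} :=
  [set p | [&& p.1 \in C, p.2 \in C &
     [&& p.1 == p.2, p.1 \notin X & p.1 \notin Y]
     || [&& p.1 \in X, p.2 \in Y & e p.1 p.2]]].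

Lemma cut_vertex C X Y v : v \in C -> v \notin X -> v \notin Y ->
  (v, v) \in cut C X Y.
Proof. by move=> Cv Xv Yv; rewrite inE /= Cv eqxx Xv Yv. Qed.

Lemma cut_edge C X Y x y : x \in C -> y \in C -> x \in X -> y \in Y -> e x y ->
  (x, y) \in cut C X Y.
Proof. by move=> Cx Cy Xx Yy exy; rewrite inE /= Cx Cy Xx Yy exy orbT. Qed.

Lemma cutS C C' X Y : C \subset C' -> cut C X Y \subset cut C' X Y.
Proof.
move=> sC; apply/subsetP => p; rewrite !inE.
by case/and3P=> /(subsetP sC) -> /(subsetP sC) -> ->.
Qed.

Lemma card_cut_disjoint C1 C2 C X Y : C1 \subset C -> C2 \subset C ->
  [disjoint C1 & C2] -> #|cut C1 X Y| + #|cut C2 X Y| <= #|cut C X Y|.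
Proof.
move=> s1 s2 dC; rewrite -cardsUI (_ : _ :&: _ = set0) ?cards0 ?addn0.
  by apply: subset_leq_card; rewrite subUset !cutS.
apply/setP => p; rewrite inE [RHS]inE [p \in cut C1 X Y]inE [p \in cut C2 X Y]inE.
apply/negP => /andP[/and3P[p1 _ _] /and3P[p2 _ _]].
by have := disjointFr dC p1; rewrite p2.
Qed.

Hypothesis e_sym : symmetric e.

(** Edges are stored as pairs directed from [X] to [Y]; swapping components reverses them and fixes
    the pairs of deleted vertices. *)
Lemma card_cutC C X Y : #|cut C X Y| = #|cut C Y X|.
Proof.
have swapK : involutive (fun p : V * V => (p.2, p.1)) by case.
rewrite -(card_imset _ (can_inj swapK)); apply: eq_card => -[a b].
apply/imsetP/idP => [[[c d] H [-> ->]]|H].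
  move: H; rewrite !inE /= [e d c]e_sym eq_sym; case: eqP => [->|_].
    by case: (_ \in C); case: (_ \in X); case: (_ \in Y).
  by case: (c \in C); case: (d \in C); case: (c \in X); case: (d \in Y).
exists (b, a) => //; move: H; rewrite !inE /= [e b a]e_sym eq_sym; case: eqP => [->|_].
  by case: (_ \in C); case: (_ \in X); case: (_ \in Y).
by case: (a \in C); case: (b \in C); case: (b \in X); case: (a \in Y).
Qed.

(* X is charged along the extra direction i, which leaves the half space of
   X, and the other vertices of its neighbourhood are charged to themselves. *)
Lemma nbhd_le_cut D i b C X Y : i \notin D ->
  (forall x, x \in C -> x \in X -> x i = b) ->
  (forall x j, x \in C -> x \in X -> j \in i |: D ->
     (flip j x \in C) && e x (flip j x)) ->
  #|nbhd D (X :&: C)| <= #|cut C X Y|.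
Proof.
move=> nDi Xb Xe.
(* [g] names the vertex that a cut element is charged to, by moving its second component into the
   half [i = b]; thus [(z, flip i z)] and [(flip i z, flip i z)] both go to [z]. *)
pose g (p : V * V) : V := [ffun j => if j == i then b else p.2 j].
apply: leq_trans (leq_imset_card g _); apply/subset_leq_card/subsetP => z.
have gE a (c : V) : (forall j, j != i -> c j = z j) -> z i = b -> z = g (a, c).
  by move=> H zi; apply/ffunP => j; rewrite ffunE; case: eqP => [->|/eqP/H].
rewrite inE in_setI; case: (boolP (z \in X)) => [Xz|nXz] /=.
  case: (boolP (z \in C)) => [Cz _|nCz] /=; last first.
    case/exists_inP => j Dj; rewrite inE => /andP[Xj Cj].
    have /andP[] := Xe _ j Cj Xj (setU1r _ Dj).
    by rewrite flipK (negbTE nCz).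
  have zi := Xb _ Cz Xz.
  have /andP[Cw ezw] := Xe _ i Cz Xz (setU11 _ _).
  have gz a : z = g (a, flip i z).
    by apply: gE => // j /negbTE nj; rewrite flipE nj.
  case: (boolP (flip i z \in Y)) => [Yw|nYw].
    by apply/imsetP; exists (z, flip i z) => //; apply: cut_edge.
  apply/imsetP; exists (flip i z, flip i z) => //; apply: cut_vertex => //.
  by apply/negP => /(Xb _ Cw); rewrite flipE eqxx zi; case: (b).
case/exists_inP => j Dj; rewrite inE => /andP[Xj Cj].
have /andP[] := Xe _ j Cj Xj (setU1r _ Dj); rewrite flipK => Cz ejz.
have gz a : z = g (a, z).
  apply: gE => //; have := Xb _ Cj Xj; rewrite flipE.
  by case: eqP => // E; move: nDi; rewrite E Dj.
case: (boolP (z \in Y)) => [Yz|nYz].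
  by apply/imsetP; exists (flip j z, z) => //; apply: cut_edge.
by apply/imsetP; exists (z, z) => //; apply: cut_vertex.
Qed.

Lemma min_deg_cap D h u C X : coset D u \subset C ->
  min_deg D h C X -> min_deg D h setT (X :&: coset D u).
Proof.
move=> sC H x _ /setIP[Xx Cx]; apply: leq_trans (H x (subsetP sC _ Cx) Xx) _.
apply/subset_leq_card/subsetP => i /setIdP[Di Xi].
by apply/setIdP; split=> //; apply/setIP; rewrite flip_coset.
Qed.


(** Induction on [#|D|], splitting along some [i]. If [X] and [Y] both meet both halves of the
    subcube, each half is a smaller instance with degree [h.-1]. *)
Lemma coset_cut D h u X Y : [disjoint X & Y] ->
  (forall x j, x \in coset D u -> j \in D -> e x (flip j x)) ->
  min_deg D h (coset D u) X -> min_deg D h (coset D u) Y ->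
  X :&: coset D u != set0 -> Y :&: coset D u != set0 ->
  2 ^ h * (#|D| - h) <= #|cut (coset D u) X Y|.
Proof.
have [n] := ubnP #|D|; elim: n D h u => // n IH D h u ltn dXY eD HX HY X0 Y0.
have [->|[i Di]] := set_0Vmem D; first by rewrite cards0 sub0n muln0.
have cD : #|D| = #|D :\ i|.+1 by rewrite (cardsD1 i) Di.
have nD : i \notin D :\ i by rewrite !inE eqxx.
(* A set confined to one half has a neighbourhood along [D :\ i] of at least [2 ^ h * (#|D| - h)]
   vertices, which [nbhd_le_cut] charges to cut elements. *)
have key b X' Y' : min_deg D h (coset D u) X' -> X' :&: coset D u != set0 ->
    half i b (X' :&: coset D u) = set0 ->
    2 ^ h * (#|D| - h) <= #|cut (coset D u) X' Y'|.
  move=> H' X'0 /half_eq0 Xb.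
  have := min_deg_unsplit Xb (min_deg_cap (subxx _) H').
  move/card_nbhd/(_ X'0); rewrite cD addn1 => /leq_trans; apply.
  apply: (@nbhd_le_cut _ i (~~ b) _ X' Y' nD).
    by move=> x Cx Xx; apply: Xb; apply/setIP.
  move=> x j Cx Xx; rewrite setD1K // => Dj.
  by rewrite flip_coset // Cx eD.
have [|Xs] := boolP [exists b, half i b (X :&: coset D u) == set0].
  by case/existsP => b /eqP; apply: key.
have [|Ys] := boolP [exists b, half i b (Y :&: coset D u) == set0].
  by case/existsP => b /eqP; rewrite card_cutC; apply: key.
pose w b := if u i == b then u else flip i u.
have wC b : w b \in coset D u.
  by rewrite /w; case: ifP; rewrite ?flip_coset // coset_refl.
have wi b : w b i = b.
  by rewrite /w; case: eqP => // /eqP; rewrite flipE eqxx; case: (u i); case: (b).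
have sub b : coset (D :\ i) (w b) \subset coset D u.
  by apply: coset_sub (wC b); apply: subD1set.
have ne b Z : ~~ [exists b, half i b (Z :&: coset D u) == set0] ->
    Z :&: coset (D :\ i) (w b) != set0.
  move/existsPn/(_ b)/set0Pn => -[z]; rewrite 2!inE => /andP[/andP[Zz /cosetP Cz] /eqP zb].
  apply/set0Pn; exists z; apply/setIP; split=> //; apply/cosetP => j.
  rewrite !inE negb_and negbK; case: eqP => [-> _|_ /= Dj]; first by rewrite wi.
  by rewrite Cz //; have /cosetP -> := wC b.
have IHb b : 2 ^ h.-1 * (#|D :\ i| - h.-1) <= #|cut (coset (D :\ i) (w b)) X Y|.
  apply: IH (ne _ _ Xs) (ne _ _ Ys) => //; first by lia.
  - move=> x j /(subsetP (sub b)) Cx; rewrite !inE => /andP[_]; exact: eD.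
  - exact: min_degD1 HX.
  - exact: min_degD1 HY.
have dC : [disjoint coset (D :\ i) (w true) & coset (D :\ i) (w false)].
  rewrite -setI_eq0; apply/eqP/setP => v; rewrite [RHS]inE; apply/negP.
  by case/setIP => /cosetP/(_ i nD) + /cosetP/(_ i nD); rewrite !wi => ->.
apply: leq_trans (card_cut_disjoint X Y (sub true) (sub false) dC).
apply: leq_trans (leq_add (IHb true) (IHb false)).
rewrite cD addnn; apply: leq_double_bound.
(* Some direction remains in [D :\ i]: otherwise a half is a single point, lying in both [X] and
   [Y]. *)
rewrite lt0n; case: eqP => //= /cards0_eq D0.
have /set0Pn[x /setIP[Xx /cosetP Cx]] := ne true _ Xs.
have /set0Pn[y /setIP[Yy /cosetP Cy]] := ne true _ Ys.
have E : x = y by apply/ffunP => j; rewrite Cx ?Cy // D0 inE.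
by move: (disjointFr dXY Xx); rewrite E Yy.
Qed.

End Cut.

(** * The exchanged cube: [o] switches sides, and [Ds c] holds the other directions available where
    [v o = c] *)

Section Exchanged.

Variables (o : I) (Ds : bool -> {set I}) (s : nat).
Hypothesis oDs : forall c, o \notin Ds c.
Hypothesis DsC : forall c i, i != o -> (i \in Ds (~~ c)) = (i \notin Ds c).
Hypothesis s_gt0 : 0 < s.
Hypothesis Ds_card : forall c, s <= #|Ds c|.

Definition dirs v := o |: Ds (v o).

Definition exch : rel V := fun u v => [exists i in dirs u, v == flip i u].

Lemma dirs_flip i v : i \in dirs v -> i \in dirs (flip i v).
Proof.
rewrite !inE flipE; case: eqP => //= /eqP; rewrite eq_sym.
by move/negbTE=> ->.
Qed.

Lemma exch_sym : symmetric exch.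
Proof.
suff H u v : exch u v -> exch v u by move=> u v; apply/idP/idP => /H.
case/exists_inP => i Di /eqP ->; apply/exists_inP; exists i; last by rewrite flipK.
exact: dirs_flip.
Qed.

Lemma exch_flip i v : i \in dirs v -> exch v (flip i v).
Proof. by move=> Di; apply/exists_inP; exists i. Qed.

Definition exch_deg h X :=
  forall x, x \in X -> h <= #|[set i in dirs x | flip i x \in X]|.

Lemma coset_o c u v : v \in coset (Ds c) u -> v o = u o.
Proof. by move/cosetP; apply. Qed.

(** Within one cube of a side, only the neighbour along [o] is lost. *)
Lemma exch_deg_coset h X c u : u o = c -> exch_deg h X ->
  min_deg (Ds c) h.-1 (coset (Ds c) u) X.
Proof.
move=> uo H x /coset_o xo Xx; have := H x Xx; rewrite /dirs xo uo.
rewrite (cardsD1 o [set i in _ | _]) => Hx.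
apply: (@leq_trans #|[set i in o |: Ds c | flip i x \in X] :\ o|).
  by move: Hx; case: (o \in _); lia.
apply/subset_leq_card/subsetP => j; rewrite !inE.
by case/andP=> /negbTE ->.
Qed.

(** Since [X] stays on one side, its inner degree comes from [Ds b] alone, and [o] is free to serve
    as the extra direction of [nbhd_le_cut]. *)
Lemma cut_one_side h b X Y : exch_deg h X -> X != set0 ->
  (forall x, x \in X -> x o = b) ->
  2 ^ h * (#|Ds b| + 1 - h) <= #|cut exch setT X Y|.
Proof.
move=> HX X0 Xb; have H : min_deg (o |: Ds b) h setT X.
  by move=> x _ Xx; have := HX x Xx; rewrite /dirs Xb.
have := min_deg_unsplit Xb H; rewrite setU1K // => /card_nbhd/(_ X0)/leq_trans; apply.
rewrite -[X in nbhd _ X]setIT; apply: (@nbhd_le_cut exch _ o b _ X Y (oDs b)).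
  by move=> x _; apply: Xb.
move=> x j _ Xx Dj; rewrite inE /=; apply: exch_flip.
by rewrite /dirs Xb.
Qed.

(* The vertices agreeing with p on Ds c induce a connected subgraph: a copy of
   the cube over Ds (~~ c) with pendant edges in direction o. It joins the copy
   of x to the copy of y, so it contains an element of the cut. *)
Lemma cut_pure_side c X Y x y : x o = c -> y o = c ->
  [disjoint coset (Ds c) x & Y] -> [disjoint coset (Ds c) y & X] ->
  2 ^ #|Ds c| <= #|cut exch setT X Y|.
Proof.
move=> xo yo dY dX.
(* All points of the subgraph [W] attached to [p] agree with [p] on [Ds c], so [g] recovers [p] from
   any cut element inside [W]. *)
pose g (p : V * V) : V := [ffun i => if i \in Ds c then p.1 i else x i].
apply: leq_trans (card_coset (Ds c) x) _; apply: leq_trans (leq_imset_card g _).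
apply/subset_leq_card/subsetP => p Kp; have /cosetP px := Kp.
have po : p o = c by rewrite (coset_o Kp).
pose W := coset (o |: Ds (~~ c)) p.
have [W0|[q qW]] := set_0Vmem (cut exch W X Y); last first.
  apply/imsetP; exists q; first exact: subsetP (cutS _ _ _ (subsetT W)) _ qW.
  move: qW; rewrite inE => /andP[/cosetP Wq _]; apply/ffunP => i; rewrite ffunE.
  case: (boolP (i \in Ds c)) => [Di|/px //]; rewrite Wq // !inE negb_or.
  have io : i != o by apply: contraNneq (oDs c) => <-.
  by rewrite io DsC // Di.
(* Without a cut element in [W], membership in [X] spreads along all edges inside [W]. *)
have WX v i : v \in W -> v \in X -> i \in dirs v -> i \in o |: Ds (~~ c) -> flip i v \in X.
  move=> Wv Xv Di Wi; apply/negPn/negP => nX.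
  have Wf : flip i v \in W by rewrite flip_coset.
  case: (boolP (flip i v \in Y)) => [Yv|nY].
    have := cut_edge Wv Wf Xv Yv (exch_flip Di).
    by rewrite W0 inE.
  by have := cut_vertex exch Wf nX nY; rewrite W0 inE.
have Wp : p \in W := coset_refl _ _.
have Xp : p \in X.
  apply/negPn/negP => nX; have nY : p \notin Y by rewrite (disjointFr dY Kp).
  by have := cut_vertex exch Wp nX nY; rewrite W0 inE.
have oW : o \in o |: Ds (~~ c) := setU11 _ _.
have Wfp : flip o p \in W by rewrite flip_coset.
have XQ : {in coset (Ds (~~ c)) (flip o p), forall v, v \in X}.
  apply: coset_connected => [v i Cv Di Xv|]; last by apply: WX => //; rewrite !inE eqxx.
  apply: WX Xv _ _.
  - by apply: (subsetP (coset_sub (subsetUr _ _) Wfp)).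
  - by rewrite !inE (coset_o Cv) flipE eqxx po Di orbT.
  - by rewrite inE Di orbT.
(* [p'] is the counterpart of [p] in the cube of [y]. The path from [p] crosses along [o], moves
   along [Ds (~~ c)] and crosses back to [p']. *)
pose p' : V := [ffun i => if i \in Ds c then p i else y i].
have p'o : p' o = c by rewrite ffunE (negbTE (oDs c)).
have Cp' : flip o p' \in coset (Ds (~~ c)) (flip o p).
  apply/cosetP => i; case: (eqVneq i o) => [-> _|io].
    by rewrite !flipE p'o po.
  by rewrite DsC // negbK !flipE (negbTE io) ffunE => ->.
have Wp' : flip o p' \in W.
  by apply: (subsetP (coset_sub (subsetUr _ _) Wfp)).
have Xp' : p' \in X.
  rewrite -[p'](flipK o); apply: WX (XQ _ Cp') _ oW => //.
  by rewrite !inE eqxx.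
have Kp' : p' \in coset (Ds c) y.
  by apply/cosetP => i /negbTE Di; rewrite ffunE Di.
by have := disjointFr dX Kp'; rewrite Xp'.
Qed.

(** Each side either yields the bound by itself or has a cube meeting both [X] and [Y]. Two such
    cubes on opposite sides are disjoint, and [leq_double_bound] adds their cuts. *)
Lemma leq_card_cut h X Y : h <= s -> [disjoint X & Y] ->
  X != set0 -> Y != set0 -> exch_deg h X -> exch_deg h Y ->
  2 ^ h * (s + 1 - h) <= #|cut exch setT X Y|.
Proof.
move=> le_hs dXY X0 Y0 HX HY.
have side c : 2 ^ h * (s + 1 - h) <= #|cut exch setT X Y| \/
    exists u, [/\ u o = c, X :&: coset (Ds c) u != set0 & Y :&: coset (Ds c) u != set0].
  have le_c b : 2 ^ h * (s + 1 - h) <= 2 ^ h * (#|Ds b| + 1 - h).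
    by rewrite leq_mul2l; have := Ds_card b; lia.
  have [/exists_inP[x Xx /eqP xo]|/exists_inPn nX] := boolP [exists x in X, x o == c]; last first.
    left; apply: leq_trans (le_c (~~ c)) (cut_one_side Y HX X0 _).
    by move=> x /nX; case: (x o); case: (c).
  have [/exists_inP[y Yy /eqP yo]|/exists_inPn nY] := boolP [exists y in Y, y o == c]; last first.
    left; rewrite (card_cutC exch_sym).
    apply: leq_trans (le_c (~~ c)) (cut_one_side X HY Y0 _).
    by move=> y /nY; case: (y o); case: (c).
  have [XY|xY] := boolP (Y :&: coset (Ds c) x != set0).
    right; exists x; split=> //; apply/set0Pn; exists x.
    by apply/setIP; rewrite coset_refl.
  have [YX|yX] := boolP (X :&: coset (Ds c) y != set0).
    right; exists y; split=> //; apply/set0Pn; exists y.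
    by apply/setIP; rewrite coset_refl.
  left; apply: leq_trans (leq_exp_bound le_hs) _.
  apply: (@leq_trans (2 ^ #|Ds c|)); first by rewrite leq_exp2l.
  apply: (cut_pure_side xo yo); rewrite disjoint_sym -setI_eq0.
    by rewrite -[_ == _]negbK.
  by rewrite -[_ == _]negbK.
have [//|[u [uo Xu Yu]]] := side true; have [//|[v [vo Xv Yv]]] := side false.
have copy c (w : V) : w o = c -> X :&: coset (Ds c) w != set0 -> Y :&: coset (Ds c) w != set0 ->
    2 ^ h.-1 * (s - h.-1) <= #|cut exch (coset (Ds c) w) X Y|.
  move=> wo Xw Yw; apply: (@leq_trans (2 ^ h.-1 * (#|Ds c| - h.-1))).
    by rewrite leq_mul2l leq_sub2r ?orbT.
  apply: coset_cut => //; try exact: exch_deg_coset.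
  - exact: exch_sym.
  - by move=> x j /coset_o xo Dj; apply: exch_flip; rewrite !inE xo wo Dj orbT.
rewrite addn1; apply: leq_trans (leq_double_bound _) _; first by rewrite s_gt0.
rewrite -addnn; apply: leq_trans (leq_add (copy _ _ uo Xu Yu) (copy _ _ vo Xv Yv)) _.
apply: card_cut_disjoint; rewrite ?subsetT //.
rewrite -setI_eq0; apply/eqP/setP => w; rewrite [RHS]inE; apply/negP.
by case/setIP => /coset_o + /coset_o; rewrite uo vo => ->.
Qed.


(** * Lower bounds for vertex cuts and edge cuts *)

Section MinimumCuts.

Variable e : rel V.
Hypothesis eE : e =2 exch.

(** Distinct neighbours in the surviving graph are flips along distinct directions, and they stay in
    the closed set. The map [f] will be [val] for vertex cuts and the identity for edge cuts. *)
Lemma exch_deg_closed h (T : finType) (f : T -> V) (e' : rel T) (Z : {set T}) :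
  injective f -> (forall z z', e' z z' -> exch (f z) (f z')) ->
  min_degree_ge e' h -> (forall z z', e' z z' -> z \in Z -> z' \in Z) ->
  exch_deg h (f @: Z).
Proof.
move=> f_inj sub /forallP deg Zc _ /imsetP[z Zz ->].
apply: leq_trans (deg z) _; rewrite /degree -(card_imset _ f_inj).
apply: leq_trans (leq_imset_card (flip ^~ (f z)) _).
apply/subset_leq_card/subsetP => _ /imsetP[z' + ->].
rewrite inE => ezz'; have /exists_inP[i Di /eqP E] := sub _ _ ezz'.
apply/imsetP; exists i => //; apply/setIdP; split=> //.
by rewrite -E imset_f // (Zc z).
Qed.

(** [Z] is the component of one of two unconnected vertices; [Z] and its complement are closed under
    adjacency and so inherit the degree bound. *)
Lemma disconnected_cut h (T : finType) (f : T -> V) (e' : rel T) :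
  h <= s -> injective f -> symmetric e' ->
  (forall z z', e' z z' -> exch (f z) (f z')) ->
  min_degree_ge e' h -> disconnected e' ->
  exists2 Z : {set T}, forall z z', e' z z' -> (z \in Z) = (z' \in Z) &
    2 ^ h * (s + 1 - h) <= #|cut exch setT (f @: Z) (f @: ~: Z)|.
Proof.
move=> le_hs f_inj e'_sym sub deg /existsP[x /existsP[y nxy]].
pose Z := [set z | connect e' x z].
have ZE z z' : e' z z' -> (z \in Z) = (z' \in Z).
  move=> ezz'; rewrite !inE; apply: same_connect_r; last exact: connect1.
  exact: sym_connect_sym.
exists Z => //; apply: leq_card_cut => //.
- rewrite -setI_eq0; apply/eqP/setP => v; rewrite [RHS]inE; apply/negP.
  case/setIP => /imsetP[z Zz ->] /imsetP[z' + /f_inj E].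
  by rewrite -E inE Zz.
- by apply/set0Pn; exists (f x); rewrite imset_f // inE connect0.
- by apply/set0Pn; exists (f y); rewrite imset_f // !inE.
- by apply: exch_deg_closed deg _ => // z z' /ZE ->.
- by apply: exch_deg_closed deg _ => // z z' /ZE E; rewrite !in_setC E.
Qed.

(** No surviving edge leaves [Z], so the mixed cut consists of pairs [(v, v)] with [v] in [S]. *)
Lemma leq_vertex_cut h S : h <= s -> vertex_cut e h S ->
  2 ^ h * (s + 1 - h) <= #|S|.
Proof.
move=> le_hs /andP[dis deg].
have e'_sym : symmetric (del_vertices e S).
  by move=> u v; rewrite /del_vertices !eE exch_sym.
have sub z z' : del_vertices e S z z' -> exch (val z) (val z').
  by rewrite /del_vertices eE.
have [Z ZE /leq_trans] := disconnected_cut le_hs val_inj e'_sym sub deg dis; apply.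
apply: leq_trans (leq_imset_card (fun v => (v, v)) S).
apply/subset_leq_card/subsetP => -[u v]; rewrite inE /= !in_setT /=.
case/orP => [/and3P[/eqP <- nX nY]|/and3P[]]; last first.
  case/imsetP=> z Zz -> /imsetP[z' + ->]; rewrite inE => Zz' ezz'.
  have /ZE : del_vertices e S z z' by rewrite /del_vertices eE.
  by rewrite Zz (negbTE Zz').
apply/imsetP; exists u => //; apply/negPn/negP => nS.
have [Zu|nZ] := boolP (Sub u nS \in Z).
  by case/imsetP: nX; exists (Sub u nS).
by case/imsetP: nY; exists (Sub u nS); rewrite // inE.
Qed.

(** All vertices survive, so the mixed cut consists of edges leaving [Z], each of which must be in
    [F]. *)
Lemma leq_edge_cut h F : h <= s -> edge_cut e h F ->
  2 ^ h * (s + 1 - h) <= #|F|.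
Proof.
move=> le_hs /and3P[_ dis deg].
have e'_sym : symmetric (del_edges e F).
  by move=> u v; rewrite /del_edges !eE exch_sym setUC.
have sub z z' : del_edges e F z z' -> exch z z' by rewrite /del_edges eE => /andP[].
have [Z ZE] := disconnected_cut le_hs (@inj_id V) e'_sym sub deg dis.
rewrite !imset_id => /leq_trans; apply.
have cutP p : p \in cut exch setT Z (~: Z) ->
    [/\ p.1 \in Z, p.2 \notin Z & exch p.1 p.2].
  rewrite inE !in_setT /= !in_setC negbK.
  by case/orP => [/and3P[_ /negbTE -> //]|/and3P].
rewrite -(@card_in_imset _ _ (fun p : V * V => [set p.1; p.2])).
  apply/subset_leq_card/subsetP => _ /imsetP[p /cutP[Z1 Z2 ep] ->].
  apply/negPn/negP => nF.
  have /ZE : del_edges e F p.1 p.2 by rewrite /del_edges eE ep.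
  by rewrite Z1 (negbTE Z2).
(* Only the first end of a cut pair lies in [Z], so the unordered edge determines the pair. *)
move=> [a b] [c d] /cutP[/= Za Zb _] /cutP[/= Zc Zd _] /setP E.
have := E a; rewrite !inE eqxx /=; case: eqP => [-> _|_ /esym/eqP ad]; last first.
  by move: Zd; rewrite -ad Za.
have := E b; rewrite !inE eqxx orbT; case: eqP => [bc _|_ /esym/eqP -> //].
by move: Zb; rewrite bc Zc.
Qed.

(** * Cuts attaining the bound *)

Lemma flipC i j v : flip i (flip j v) = flip j (flip i v).
Proof. by apply/ffunP => k; rewrite !flipE addbCA. Qed.

Definition origin : V := [ffun=> false].

(** A point of this subcube is determined by its support, a subset of [H]. *)
Lemma card_coset_origin H : #|coset H origin| <= 2 ^ #|H|.
Proof.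
have supp_inj : injective (fun v : V => [set i | v i]).
  by move=> u v /setP E; apply/ffunP => i; move: (E i); rewrite !inE.
rewrite -card_powerset -(card_imset _ supp_inj).
apply/subset_leq_card/subsetP => _ /imsetP[v /cosetP Cv ->].
rewrite powersetE; apply/subsetP => i; rewrite inE; apply: contraLR => Hi.
by rewrite Cv // ffunE.
Qed.

Section Optimal.

Variable H : {set I}.
Hypothesis H_sub : H \subset Ds false.
Hypothesis card_Ds : #|Ds false| = s.

Let X := coset H origin.
(** The directions of the edges that leave the subcube [X], the same at each of its points. *)
Let R := (o |: Ds false) :\: H.

Let X0 x i : x \in X -> i \notin H -> x i = false.
Proof. by move=> /cosetP Xx /Xx ->; rewrite ffunE. Qed.

Let oH : o \notin H.
Proof. by apply: contra (oDs false); apply: (subsetP H_sub). Qed.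

Let le_Hs : #|H| <= s.
Proof. by rewrite -card_Ds; apply: subset_leq_card. Qed.

Let dirsX x i : x \in X -> i \in dirs x -> i \notin H -> i \in R.
Proof. by move=> Xx; rewrite /dirs (X0 Xx oH) => Di Hi; apply/setDP. Qed.

Let R_dirs x i : x \in X -> i \in R -> i \in dirs x.
Proof. by move=> Xx; rewrite /dirs (X0 Xx oH) => /setDP[]. Qed.

Let R_true i : i \in R -> i \notin Ds true.
Proof.
rewrite !inE => /andP[_ /orP[/eqP -> //|Di]].
have io : i != o by apply: contraNneq (oDs false) => <-.
by rewrite -(DsC _ io).
Qed.

Let true_neq_o i : i \in Ds true -> i != o.
Proof. by apply: contraTneq => ->. Qed.

Let true_H i : i \in Ds true -> i \notin H.
Proof.
move=> Di; apply/negP => /(subsetP H_sub).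
by rewrite (DsC true (true_neq_o Di)) Di.
Qed.

(** Provides a vertex to separate from [X]. Points of [X] and their neighbours along [R] vanish on
    [Ds true], so the nonzero coordinate there keeps this vertex out of the vertex cut. *)
Let far : exists2 v : V, v o & exists2 i, i \in Ds true & v i.
Proof.
have [] := set_0Vmem (Ds true).
  by move=> E; have := Ds_card true; rewrite E cards0 leqNgt s_gt0.
case=> j Dj; exists [ffun i => (i == o) || (i == j)]; first by rewrite ffunE eqxx.
by exists j; rewrite // ffunE eqxx orbT.
Qed.

Let card_R : #|X| * #|R| <= 2 ^ #|H| * (s + 1 - #|H|).
Proof.
apply: leq_mul; first exact: card_coset_origin.
rewrite cardsD (setIidPr _); last exact: subset_trans H_sub (subsetUr _ _).
by rewrite cardsU1 oDs card_Ds addnC.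
Qed.

(** [S] is the set of outer neighbours of [X]. Both [X] and [S] are invariant under flips along [H],
    and [S] vanishes on [Ds true]; the degree bound rests on these facts. *)
Lemma vertex_cut_origin :
  exists2 S, vertex_cut e #|H| S & #|S| <= 2 ^ #|H| * (s + 1 - #|H|).
Proof.
pose S := [set flip p.2 p.1 | p in setX X R].
have SP v : reflect (exists x i, [/\ x \in X, i \in R & v = flip i x]) (v \in S).
  apply: (iffP imsetP) => [[[x i] /setXP[Xx Ri] ->]|[x [i [Xx Ri ->]]]].
    by exists x, i.
  by exists (x, i) => //; apply/setXP.
have S_true v i : i \in Ds true -> v i -> v \notin S.
  move=> Di vi; apply/SP => -[x [j [Xx Rj E]]]; move: vi.
  rewrite E flipE (X0 Xx (true_H Di)) addbF => /eqP ij.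
  by move: (R_true Rj); rewrite -ij Di.
have nS0 : origin \notin S.
  apply/SP => -[x [j [Xx Rj /ffunP/(_ j)]]].
  have jH : j \notin H by case/setDP: Rj.
  by rewrite flipE eqxx (X0 Xx jH) ffunE.
have S_H v i : i \in H -> v \notin S -> flip i v \notin S.
  move=> Hi; apply: contra => /SP[x [j [Xx Rj E]]]; apply/SP.
  exists (flip i x), j; rewrite flip_coset // flipC -E flipK.
  by split.
exists S; last first.
  by apply: leq_trans (leq_imset_card _ _) _; rewrite cardsX card_R.
have eS_sym : symmetric (del_vertices e S).
  by move=> u v; rewrite /del_vertices !eE exch_sym.
apply/andP; split.
  have [v vo [i Di vi]] := far; have nSv := S_true _ _ Di vi.
  apply/existsP; exists (Sub origin nS0); apply/existsP; exists (Sub v nSv).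
  have cl : closed (del_vertices e S) [pred z | val z \in X].
    apply: intro_closed; first exact: sym_connect_sym.
    move=> x [y nSy]; rewrite /del_vertices eE => /exists_inP[j Dj /= /eqP E] Xx.
    rewrite inE /= E; have [Hj|nHj] := boolP (j \in H).
      by rewrite /X flip_coset.
    by case/SP: nSy; exists (val x), j; rewrite (dirsX Xx Dj nHj).
  apply/negP => /(closed_connect cl); rewrite inE /= coset_refl.
  by move=> /esym /X0 /(_ oH); rewrite vo.
apply/forallP => -[v nS]; rewrite /degree.
have deg (A : {set I}) : A \subset dirs v -> {in A, forall i, flip i v \notin S} ->
    #|A| <= #|[set y | del_vertices e S (exist _ v nS) y]|.
  move=> Av AS; rewrite -(card_imset _ (@flip_inj v)) -(card_imset _ val_inj).
  apply/subset_leq_card/subsetP => _ /imsetP[i Ai ->].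
  apply/imsetP; exists (Sub (flip i v) (AS i Ai)) => //.
  by rewrite inE /del_vertices eE exch_flip //; apply: (subsetP Av).
(* On the side [o = false] the directions in [H] give enough surviving neighbours. *)
have [vo|/negbTE vo] := boolP (v o); last first.
  apply: deg => [|i Hi]; last exact: S_H.
  by rewrite /dirs vo; apply: subset_trans H_sub (subsetUr _ _).
(* A nonzero coordinate [j] in [Ds true] survives every flip except the one along [j], so at most
   one neighbour is lost. If there is none, each flip along [Ds true] creates one. *)
have [[j Dj vj]|nv] := altP (@exists_inP _ (mem (Ds true)) v).
  apply: leq_trans le_Hs (leq_trans (Ds_card true) _).
  have -> : #|Ds true| = #|(o |: Ds true) :\ j|.
    have := cardsD1 j (o |: Ds true).
    by rewrite setU1r // cardsU1 oDs; lia.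
  apply: deg => [|i]; first by rewrite /dirs vo subD1set.
  by case/setD1P=> ij _; apply: (S_true _ _ Dj); rewrite flipE eq_sym (negbTE ij) vj.
apply: leq_trans le_Hs (leq_trans (Ds_card true) _).
apply: deg => [|i Di]; first by rewrite /dirs vo subsetUr.
apply: (S_true _ _ Di); rewrite flipE eqxx /=; apply/negP => vi.
by case/negP: nv; apply/exists_inP; exists i.
Qed.

(** [F] is the set of edges leaving [X], all with direction in [R]. The directions [H] on the side
    [o = false] and [Ds true] on the other avoid [R], so their edges survive. *)
Lemma edge_cut_origin :
  exists2 F, edge_cut e #|H| F & #|F| <= 2 ^ #|H| * (s + 1 - #|H|).
Proof.
pose F := [set [set p.1; flip p.2 p.1] | p in setX X R].
have flip_neq i v : flip i v != v.
  by apply/eqP => /ffunP/(_ i); rewrite flipE eqxx; case: (v i).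
(* An edge determines its direction, whichever of its ends lies in [X]. *)
have FR v i : [set v; flip i v] \in F -> i \in R.
  case/imsetP => -[x j] /setXP[/= _ Rj] /setP E.
  have : v \in [set x; flip j x] by rewrite -E set21.
  have : flip i v \in [set x; flip j x] by rewrite -E set22.
  move=> /set2P[] Ei /set2P[] Ev; move: (flip_neq i v).
  - by rewrite Ei Ev eqxx.
  - have ij : i = j; last by rewrite ij.
    by apply: (@flip_inj v); rewrite Ei Ev flipK.
  - by move: Ei; rewrite Ev => /flip_inj ->.
  - by rewrite Ei Ev eqxx.
exists F; last first.
  by apply: leq_trans (leq_imset_card _ _) _; rewrite cardsX card_R.
have eF_sym : symmetric (del_edges e F).
  by move=> u v; rewrite /del_edges !eE exch_sym setUC.
apply/and3P; split.
- apply/subsetP => _ /imsetP[[x i] /setXP[Xx Ri] ->].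
  apply/imsetP; exists (x, flip i x) => //.
  by rewrite inE eE exch_flip // R_dirs.
- have [v vo _] := far; apply/existsP; exists origin; apply/existsP; exists v.
  have cl : closed (del_edges e F) (mem X).
    apply: intro_closed; first exact: sym_connect_sym.
    move=> x y /andP[]; rewrite eE => /exists_inP[j Dj /eqP ->] nF Xx.
    have [Hj|nHj] := boolP (j \in H); first by rewrite /X flip_coset.
    case/imsetP: nF; exists (x, j) => //; apply/setXP; split=> //.
    exact: dirsX Dj nHj.
  apply/negP => /(closed_connect cl); rewrite coset_refl.
  by move=> /esym /X0 /(_ oH); rewrite vo.
apply/forallP => v; rewrite /degree.
have deg (A : {set I}) : A \subset dirs v -> {in A, forall i, i \notin R} ->
    #|A| <= #|[set y | del_edges e F v y]|.
  move=> Av AR; rewrite -(card_imset _ (@flip_inj v)).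
  apply/subset_leq_card/subsetP => _ /imsetP[i Ai ->].
  rewrite inE /del_edges eE exch_flip ?(subsetP Av) //.
  by apply: contra (AR i Ai); apply: FR.
have [vo|/negbTE vo] := boolP (v o).
  apply: leq_trans le_Hs (leq_trans (Ds_card true) _).
  apply: deg => [|i Di]; first by rewrite /dirs vo subsetUr.
  by apply: contraL Di; apply: R_true.
apply: deg => [|i Hi]; last by rewrite inE Hi.
by rewrite /dirs vo; apply: subset_trans H_sub (subsetUr _ _).
Qed.

End Optimal.
End MinimumCuts.
End Exchanged.
End Cube.

(** * Minimum cardinalities and the exchanged hypercube of bit strings *)

Lemma min_cardE (T : finType) (P : pred {set T}) n :
  (exists2 A, P A & #|A| <= n) -> (forall A, P A -> n <= #|A|) ->
  min_card P = Some n.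
Proof.
move=> [A PA leA] minP; rewrite /min_card; case: pickP => [B|/(_ A)/negP[]].
  case/andP=> PB /forallP/(_ A); rewrite PA /= => leBA; congr Some.
  by apply/eqP; rewrite eqn_leq minP // andbT (leq_trans leBA).
rewrite PA; apply/forallP => B; apply/implyP => /minP.
exact: leq_trans.
Qed.

Section ExchangedHypercube.

Variables s t : nat.

Definition dims (c : bool) : {set 'I_(s + t).+1} :=
  [set i : 'I_(s + t).+1 | if c then 1 <= i <= t else t + 1 <= i <= s + t].

Lemma ord0_dims c : ord0 \notin dims c.
Proof. by rewrite inE /=; case: c => //; rewrite addn1. Qed.

Lemma dimsN c i : i != ord0 -> (i \in dims (~~ c)) = (i \notin dims c).
Proof.
rewrite -val_eqE /= => i0; have := ltn_ord i; rewrite !inE.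
by case: c => /=; lia.
Qed.

Lemma card_dims c : #|dims c| = if c then t else s.
Proof.
have card_interval n a b : b < n -> #|[set i : 'I_n | a <= i <= b]| = b.+1 - a.
  move=> ltbn; rewrite -sum1dep_card -(big_mkord (fun i => a <= i <= b) (fun=> 1)).
  rewrite -[RHS]muln1 -sum_nat_const_nat (big_nat_widenl a 0) //.
  by rewrite (big_nat_widen 0 b.+1 n).
by rewrite /dims; case: c; rewrite card_interval; lia.
Qed.

Lemma EH_exch : EH s t =2 exch ord0 dims.
Proof.
have diffE u v r : differ_exactly_at u v r = (v == flip r u).
  apply/forallP/eqP => [H|-> i].
    apply/ffunP => i; have := H i; rewrite flipE.
    by case: (i == r); case: (u i); case: (v i).
  by rewrite flipE; case: (i == r); case: (u i).
move=> u v; rewrite /EH; apply/idP/exists_inP.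
  case/or3P => [|/existsP[r]|/existsP[r]].
  - by rewrite diffE; exists ord0; rewrite // !inE eqxx.
  - case/and4P=> Hr; rewrite diffE => vr /eqP uo _; exists r => //.
    by rewrite !inE uo Hr orbT.
  - case/and4P=> Hr; rewrite diffE => vr /eqP uo _; exists r => //.
    by rewrite !inE uo Hr orbT.
case=> r + vr; rewrite /dirs !inE => /orP[/eqP r0|].
  by rewrite diffE -r0 vr.
move=> Hr; have r0 : r != ord0.
  by apply/eqP => r0; move: Hr; rewrite r0; case: ifP => //; rewrite addn1.
(* A flip away from position 0 keeps the last bit, so the condition on the second end follows from
   that on the first. *)
have vo : v ord0 = u ord0 by rewrite (eqP vr) flipE eq_sym (negbTE r0).
apply/orP; right; move: Hr; case: ifP => uo Hr; apply/orP; [left|right];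
  by apply/existsP; exists r; rewrite diffE vr Hr vo uo.
Qed.

End ExchangedHypercube.

Theorem theorem3p4 (s t h : nat) (hs : 1 <= s) (hst : s <= t) (hh : h <= s) :
  kappa h (EH s t) = lambda h (EH s t) /\
  lambda h (EH s t) = Some (2 ^ h * (s + 1 - h)).
Proof.
have oD := @ord0_dims s t; have DN := @dimsN s t.
(* The side [u_0 = 1] has [t] directions, whence the use of [s <= t]. *)
have le_s c : s <= #|dims s t c| by rewrite card_dims; case: c.
have eE := @EH_exch s t.
(* There are ['C(s, h)] such sets, a positive number since [h <= s]. *)
have [H H_sub cardH] : exists2 H : {set 'I_(s + t).+1}, H \subset dims s t false & #|H| = h.
  have : 0 < #|[set H : {set 'I_(s + t).+1} | H \subset dims s t false & #|H| == h]|.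
    by rewrite cards_draws card_dims bin_gt0.
  by case/card_gt0P => H; rewrite inE => /andP[? /eqP ?]; exists H.
have card_s : #|dims s t false| = s by rewrite card_dims.
have kE : kappa h (EH s t) = Some (2 ^ h * (s + 1 - h)).
  apply: min_cardE => [|S]; last exact: (leq_vertex_cut oD DN hs le_s eE hh).
  by have := vertex_cut_origin oD DN hs le_s eE H_sub card_s; rewrite cardH.
have lE : lambda h (EH s t) = Some (2 ^ h * (s + 1 - h)).
  apply: min_cardE => [|F]; last exact: (leq_edge_cut oD DN hs le_s eE hh).
  by have := edge_cut_origin oD DN hs le_s eE H_sub card_s; rewrite cardH.
by rewrite kE lE.
Qed.
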